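(* For every $\delta$-algebra $A$, the underlying MV-algebra of $A$ is semisimple, i.e. the intersection of all maximal ideals of the MV-algebra $(A,\oplus,\neg,0)$ is $\{0\}$.
   Context: An MV-algebra is a structure $(A,\oplus,\neg,0)$ such that $(A,\oplus,0)$ is a commutative monoid, $\neg\neg x=x$, $x\oplus\neg 0=\neg 0$, and $\neg(\neg x\oplus y)\oplus y=\neg(\neg y\oplus x)\oplus x$. Write $1:=\neg 0$, $x\odot y:=\neg(\neg x\oplus\neg y)$, $x\ominus y:=x\odot\neg y$, $d(x,y):=(x\ominus y)\oplus(y\ominus x)$; $x\le y$ iff $x\ominus y=0$ defines a lattice order with $x\vee y=\neg(\neg x\oplus y)\oplus y$. An ideal is a subset containing $0$, downward closed and closed under $\oplus$; maximal ideals are the proper ideals maximal under inclusion. A $\delta$-algebra is a structure $(A,\delta,\oplus,\neg,0)$ where $(A,\oplus,\neg,0)$ is an MV-algebra and $\delta$ is an operation of countably infinite arity such that, writing $\vec x=(x_1,x_2,\ldots)$, $\vec 0=(0,0,\ldots)$ and $f_{1/2}(x):=\delta(x,\vec 0)$: (A1) $d(\delta(\vec x),\delta(x_1,\vec 0))=\delta(0,x_2,x_3,\ldots)$; (A2) $f_{1/2}(\delta(\vec x))=\delta(f_{1/2}(x_1),f_{1/2}(x_2),\ldots)$; (A3) $\delta(x,x,\ldots)=x$; (A4) $\delta(0,\vec x)=f_{1/2}(\delta(\vec x))$; (A5) $\delta(x_1\oplus y_1,x_2\oplus y_2,\ldots)\ge\delta(x_1,x_2,\ldots)$; (A6) $f_{1/2}(x\ominus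 y)=f_{1/2}(x)\ominus f_{1/2}(y)$. *)

(* Defs.v *)
From mathcomp Require Import all_boot.
From mathcomp Require Import classical_sets.
Set Implicit Arguments.
Unset Strict Implicit.
Unset Printing Implicit Defensive.
Local Open Scope classical_set_scope.

Record mvAlgebra := MVAlgebra {
  mv_sort :> Type;
  oplus : mv_sort -> mv_sort -> mv_sort;
  neg : mv_sort -> mv_sort;
  zero : mv_sort;
  oplusA : associative oplus;
  oplusC : commutative oplus;
  oplus0 : right_id zero oplus;
  negK : involutive neg;
  oplus_neg0 : forall x, oplus x (neg zero) = neg zero;
  lukasiewicz : forall x y,
    oplus (neg (oplus (neg x) y)) y = oplus (neg (oplus (neg y) x)) x
}.

Arguments oplus {m} x y.
Arguments neg {m} x.
Arguments zero {m}.

Section MVOperations.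
Variable A : mvAlgebra.
Implicit Types (x y : A) (I J : set A).

Definition odot x y : A := neg (oplus (neg x) (neg y)).

Definition ominus x y : A := odot x (neg y).

Definition mv_dist x y : A := oplus (ominus x y) (ominus y x).

Definition mv_le x y : Prop := ominus x y = zero.

Definition mv_ideal I : Prop :=
  [/\ I zero,
      forall x y, I y -> mv_le x y -> I x
    & forall x y, I x -> I y -> I (oplus x y)].

Definition mv_proper_ideal I : Prop := mv_ideal I /\ I <> setT.

Definition mv_maximal_ideal I : Prop :=
  mv_proper_ideal I /\ forall J, mv_proper_ideal J -> I `<=` J -> J = I.

End MVOperations.

(* The one-element algebra has no maximal ideal; the empty intersection is then
   the whole algebra, so that this algebra is semisimple. *)
Definition mv_semisimple (A : mvAlgebra) : Prop :=
  \bigcap_(I in [set I : set A | mv_maximal_ideal I]) I = [set zero].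

Definition scons (T : Type) (a : T) (x : nat -> T) : nat -> T :=
  fun n => if n is m.+1 then x m else a.

(* f_{1/2}(x) = delta(x, 0, 0, ...) *)
Definition half_of (A : mvAlgebra) (delta : (nat -> A) -> A) (x : A) : A :=
  delta (scons x (fun=> zero)).

(* A sequence (x_1, x_2, ...) is a function on nat whose value at 0 is x_1. *)
Record deltaAlgebra := DeltaAlgebra {
  delta_mv :> mvAlgebra;
  delta : (nat -> delta_mv) -> delta_mv;
  delta_dist : forall x : nat -> delta_mv,
    mv_dist (delta x) (delta (scons (x 0) (fun=> zero)))
    = delta (scons zero (fun n => x n.+1));
  half_delta : forall x : nat -> delta_mv,
    half_of delta (delta x) = delta (fun n => half_of delta (x n));
  delta_const : forall x : delta_mv, delta (fun=> x) = x;
  delta_shift : forall x : nat -> delta_mv,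
    delta (scons zero x) = half_of delta (delta x);
  delta_oplus_ge : forall x y : nat -> delta_mv,
    mv_le (delta x) (delta (fun n => oplus (x n) (y n)));
  half_ominus : forall x y : delta_mv,
    half_of delta (ominus x y) = ominus (half_of delta x) (half_of delta y)
}.

(* Main.v *)
From mathcomp Require Import all_boot.
From mathcomp Require Import boolp classical_sets.
Require Import Defs.

(** An element that lies in every maximal ideal is infinitesimal: if [u], a
multiple of [x], does not satisfy [u <= ¬u], the elements disjoint from
[u ⊙ u] form a proper ideal containing [¬u ⊙ ¬u], and a maximal ideal that
contains both this ideal and [u] would contain [¬u].  A delta-algebra has no
nonzero infinitesimal: if [x] is one, then [2^n x] is the half of
[2^(n+1) x], so that [y = δ(x, 2x, 4x, ...)] satisfies
[y ⊖ x/2 = δ(x, 2x, 4x, ...) = y], whence [x/2 = 0]. *)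

Set Implicit Arguments.
Unset Strict Implicit.
Unset Printing Implicit Defensive.
Local Open Scope classical_set_scope.

Local Notation "x ⊕ y" := (oplus x y) (at level 50, left associativity).
Local Notation "x ⊖ y" := (ominus x y) (at level 50, left associativity).
Local Notation "x ≤ y" := (mv_le x y) (at level 70, no associativity).
Local Notation "¬ x" := (neg x) (at level 35, right associativity).

Section MVTheory.
Variable A : mvAlgebra.
Implicit Types x y z a b t u : A.

Lemma mv_0oplus x : zero ⊕ x = x.
Proof. by rewrite oplusC oplus0. Qed.

Lemma mv_oplusN x : x ⊕ ¬ x = ¬ zero.
Proof.
have := lukasiewicz x (¬ zero).
by rewrite !oplus_neg0 negK mv_0oplus oplusC.
Qed.

Lemma ominusE x y : x ⊖ y = ¬ (¬ x ⊕ y).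
Proof. by rewrite /ominus /odot negK. Qed.

Lemma ominus_neg x y : ¬ x ⊖ ¬ y = y ⊖ x.
Proof. by rewrite !ominusE negK oplusC. Qed.

Lemma ominusA x y z : x ⊖ y ⊖ z = x ⊖ (y ⊕ z).
Proof. by rewrite !ominusE negK oplusA. Qed.

Lemma ominus0 x : x ⊖ zero = x.
Proof. by rewrite ominusE oplus0 negK. Qed.

Lemma ominus1 x : x ⊖ ¬ zero = zero.
Proof. by rewrite ominusE oplus_neg0 negK. Qed.

Lemma ominus_oplusC x y : x ⊖ y ⊕ y = y ⊖ x ⊕ x.
Proof. by rewrite !ominusE lukasiewicz. Qed.

Lemma mv_leE x y : x ≤ y <-> ¬ x ⊕ y = ¬ zero.
Proof.
rewrite /mv_le ominusE; split=> [<-|->]; last by rewrite negK.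
by rewrite negK.
Qed.

Lemma mv_lexx x : x ≤ x.
Proof. by apply/mv_leE; rewrite oplusC mv_oplusN. Qed.

Lemma mv_le_oplusl x y : x ≤ x ⊕ y.
Proof.
by apply/mv_leE; rewrite oplusA (oplusC (¬ x)) mv_oplusN oplusC oplus_neg0.
Qed.

Lemma mv_le_oplusr x y : x ≤ y ⊕ x.
Proof. by rewrite oplusC; apply: mv_le_oplusl. Qed.

Lemma ominusK x y : x ≤ y -> y ⊖ x ⊕ x = y.
Proof. by rewrite ominus_oplusC => ->; rewrite mv_0oplus. Qed.

Lemma mv_le_trans y x z : x ≤ y -> y ≤ z -> x ≤ z.
Proof.
by move=> /ominusK <- /ominusK <-; rewrite oplusA; apply: mv_le_oplusr.
Qed.

Lemma mv_le_anti x y : x ≤ y -> y ≤ x -> x = y.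
Proof. by move=> xy yx; rewrite -(ominusK xy) yx mv_0oplus. Qed.

Lemma mv_le_add2r z x y : x ≤ y -> x ⊕ z ≤ y ⊕ z.
Proof. by move=> /ominusK <-; rewrite -oplusA; apply: mv_le_oplusr. Qed.

Lemma mv_le_neg x y : x ≤ y -> ¬ y ≤ ¬ x.
Proof. by rewrite /mv_le ominus_neg. Qed.

Lemma ominus_le_oplus x y z : x ⊖ y ≤ z <-> x ≤ y ⊕ z.
Proof. by rewrite !mv_leE ominusE negK oplusA. Qed.

Lemma ominus_le x y : x ⊖ y ≤ x.
Proof. by apply/ominus_le_oplus; apply: mv_le_oplusr. Qed.

Lemma ominus_anti z x y : x ≤ y -> z ⊖ y ≤ z ⊖ x.
Proof.
move=> xy; rewrite !ominusE; apply: mv_le_neg.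
by rewrite !(oplusC (¬ z)); apply: mv_le_add2r.
Qed.

(* There is no symbol for the meet: it is written [x ⊖ (x ⊖ y)]. *)
Lemma mv_meetC x y : x ⊖ (x ⊖ y) = y ⊖ (y ⊖ x).
Proof.
by rewrite (ominusE x) (ominusE y) -(ominus_neg y x) -(ominus_neg x y)
  !(oplusC (¬ _) (_ ⊖ _)) ominus_oplusC.
Qed.

Lemma mv_meetr x y : y ≤ x -> x ⊖ (x ⊖ y) = y.
Proof. by rewrite mv_meetC => ->; rewrite ominus0. Qed.

Lemma mv_meet_glb x y z : z ≤ x -> z ≤ y -> z ≤ x ⊖ (x ⊖ y).
Proof.
by move=> zx zy; rewrite -{1}(mv_meetr zx); do 2![apply: ominus_anti].
Qed.

(** The hypothesis says that the sum is not truncated at [¬ zero]. *)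
Lemma oplusK x y : y ≤ ¬ x -> x ⊕ y ⊖ x = y.
Proof.
move/mv_le_neg; rewrite negK => /ominusK; rewrite [_ ⊖ x]ominusE negK.
by rewrite ominusE (oplusC y) => ->; rewrite negK.
Qed.

(* Prelinearity: [a ⊖ b = a] says that the meet of [a] and [b] is zero. *)
Lemma ominus_disjoint x y : x ⊖ y ⊖ (y ⊖ x) = x ⊖ y.
Proof.
apply: mv_le_anti; first exact: ominus_le.
rewrite /mv_le; set t := _ ⊖ _; set m := x ⊖ (x ⊖ y).
have tx : t ≤ x ⊖ m by rewrite mv_meetr; apply: ominus_le.
have ty : t ≤ y ⊖ m.
  by rewrite /m mv_meetC mv_meetr ?[t]mv_meetC; apply: ominus_le.
have mx : m ≤ x by apply: ominus_le.
have my : m ≤ y by rewrite /m mv_meetC; apply: ominus_le.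
(* The goal is [t = zero]. Adding [m] keeps [t] below both [x] and [y], hence below their meet [m];
   the sum is not truncated, so [m] cancels. *)
have tm : t ⊕ m ≤ m.
  apply: mv_meet_glb.
    by rewrite -[X in _ ≤ X](ominusK mx); apply: mv_le_add2r.
  by rewrite -[X in _ ≤ X](ominusK my); apply: mv_le_add2r.
rewrite -(@oplusK m t) 1?oplusC //; apply: mv_le_trans tx _.
by rewrite ominusE; apply/mv_le_neg/mv_le_oplusr.
Qed.

Lemma mv_ideal_disjoint a : mv_ideal [set x | a ⊖ x = a].
Proof.
split=> [|x y /= ay xy|x y /= ax ay]; first exact: ominus0.
  apply: mv_le_anti; first exact: ominus_le.
  by rewrite -{1}ay; apply: ominus_anti.
by rewrite -ominusA ax.
Qed.

Lemma mv_proper_idealE (I : set A) : mv_ideal I ->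
  mv_proper_ideal I <-> ~ I (¬ zero).
Proof.
move=> idI; split=> [[_ ne] I1|nI1]; last first.
  by split=> // eT; apply: nI1; rewrite eT.
apply: ne; apply/seteqP; split=> // x _.
case: idI => _ + _; apply; first exact: I1.
exact: ominus1.
Qed.

Lemma mv_maximal_ideal_exists (I : set A) : mv_proper_ideal I ->
  exists2 M, mv_maximal_ideal M & I `<=` M.
Proof.
(* Uniting with [I] makes the property hold for the union of the empty chain too, and forces the
   maximal ideal to contain [I]. *)
move=> pI; pose P J := mv_proper_ideal (I `|` J).
have [F FP totF|J [PJ maxJ]] := @Zorn_bigcup A P.
  have [->|/set0P[J0 FJ0]] := eqVneq F set0.
    by rewrite /P bigcup_set0 setU0.
  have inF J x : F J -> (I `|` J) x -> (I `|` \bigcup_(X in F) X) x.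
    by move=> FJ [|Jx]; [left|right; exists J].
  have Fin x : (I `|` \bigcup_(X in F) X) x -> exists2 J, F J & (I `|` J) x.
    by case=> [Ix|[J FJ Jx]]; [exists J0 => //; left|exists J => //; right].
  have idF : mv_ideal (I `|` \bigcup_(X in F) X).
    split=> [|x y /Fin[J FJ Jy] xy|x y /Fin[J FJ Jx] /Fin[K FK Ky]].
    - by left; case: pI => [[]].
    - by apply: (inF J) => //; have [[_ le _] _] := FP J FJ; apply: le Jy xy.
    - have [JK|KJ] := totF _ _ FJ FK.
        have [[_ _ add] _] := FP K FK; apply: (inF K) => //; apply: add => //.
        by case: Jx => [|/JK]; [left|right].
      have [[_ _ add] _] := FP J FJ; apply: (inF J) => //; apply: add => //.
      by case: Ky => [|/KJ]; [left|right].
  apply/(mv_proper_idealE idF) => /Fin[J FJ].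
  by apply/mv_proper_idealE; case: (FP J FJ) => //; apply: FP.
exists (I `|` J); last exact: subsetUl.
split=> // K pK IJK; have JK : J `<=` K by move=> x Jx; apply: IJK; right.
have PK : P K.
  rewrite /P; suff -> : I `|` K = K by [].
  by apply/setUidPr => x Ix; apply: IJK; left.
have KJ : K `<=` J by apply: contrapT => nKJ; apply: (maxJ K).
by apply/seteqP; split=> // x /KJ; right.
Qed.

(** The truncated multiple 2^n u, built by doubling so that [halfK] can take each term back to the
    previous one. *)
Fixpoint dyadic_multiple u n :=
  if n is m.+1 then dyadic_multiple u m ⊕ dyadic_multiple u m else u.

Lemma mv_ideal_dyadic_multiple (I : set A) u n :
  mv_ideal I -> I u -> I (dyadic_multiple u n).
Proof. by case=> _ _ ID Iu; elim: n => //= n IHn; apply: ID. Qed.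

Lemma maximal_ideal_infinitesimal u :
  (forall M : set A, mv_maximal_ideal M -> M u) ->
  forall n, dyadic_multiple u n ≤ ¬ dyadic_multiple u n.
Proof.
move=> allM n; set v := dyadic_multiple u n; apply: contrapT => nv.
have idI := @mv_ideal_disjoint (v ⊖ ¬ v).
have [|M maxM IM] := @mv_maximal_ideal_exists
  [set x | v ⊖ ¬ v ⊖ x = v ⊖ ¬ v].
  (* If [¬ zero] were disjoint from [v ⊖ ¬ v], the latter would vanish, which is [v ≤ ¬ v]. *)
  by apply/(mv_proper_idealE idI) => /=; rewrite ominus1 => /esym.
have pM := maxM.1; have idM := pM.1.
have Mv : M v by apply: mv_ideal_dyadic_multiple => //; apply: allM.
have Md : M (¬ v ⊖ v) by apply: IM; apply: ominus_disjoint.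
have /(mv_proper_idealE idM) := pM; apply; case: idM => _ Mle Madd.
(* [¬ v ⊖ v ⊕ v] is the join of [¬ v] and [v]. *)
have MNv : M (¬ v).
  apply: (Mle _ (¬ v ⊖ v ⊕ v)); first exact: Madd.
  by rewrite ominus_oplusC; apply: mv_le_oplusr.
by rewrite -(mv_oplusN v); apply: Madd.
Qed.

End MVTheory.

Section DeltaTheory.
Variable A : deltaAlgebra.
Implicit Types (x y u : A) (s : nat -> A).

Local Notation half := (half_of (@delta A)).

(** (A5), with [s] split as its first entry followed by zeros plus its tail preceded by zero. *)
Lemma half_le_delta s : half (s 0) ≤ delta s.
Proof.
rewrite /half_of; have := delta_oplus_ge (scons (s 0) (fun=> zero))
  (scons zero (fun n => s n.+1)).
congr (_ ≤ delta _); apply/funext => -[|n] /=; first by rewrite oplus0.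
by rewrite mv_0oplus.
Qed.

(** (A1) and (A4): one of the two differences in the distance vanishes by [half_le_delta]. *)
Lemma delta_ominus_half s :
  delta s ⊖ half (s 0) = half (delta (fun n => s n.+1)).
Proof.
rewrite -delta_shift -delta_dist /mv_dist.
by rewrite (half_le_delta s : half_of _ _ ⊖ _ = _) oplus0.
Qed.

(** On a constant sequence, (A3) turns [delta_ominus_half] into [u ⊖ half u = half u]. *)
Lemma half_double u : half u ⊕ half u = u.
Proof.
have := half_le_delta (fun=> u); have := delta_ominus_half (fun=> u).
by rewrite !delta_const => uE /ominusK; rewrite uE.
Qed.

Lemma half0 : half zero = zero.
Proof.
rewrite -[RHS](delta_const zero) /half_of; congr delta.
by apply/funext => -[].
Qed.

(** By (A6) and cancellation, [half (u ⊕ u)] exceeds [half u] by [half u], so it is twice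
    [half u]. *)
Lemma halfK u : u ≤ ¬ u -> half (u ⊕ u) = u.
Proof.
move=> uNu; have le : half u ≤ half (u ⊕ u).
  by rewrite /mv_le -half_ominus mv_le_oplusl half0.
by rewrite -(ominusK le) -half_ominus oplusK // half_double.
Qed.

Lemma infinitesimal0 u :
  (forall n, dyadic_multiple u n ≤ ¬ dyadic_multiple u n) -> u = zero.
Proof.
move=> infu; pose y := delta (dyadic_multiple u).
have yE : y ⊖ half u = y.
  rewrite (delta_ominus_half (dyadic_multiple u)) half_delta; congr delta.
  by apply/funext => n /=; apply: halfK.
(* The meet of [y] and [half u] is [half u], as [half u ≤ y], but also [y ⊖ y] by [yE]. *)
have := mv_meetr (half_le_delta (dyadic_multiple u)); rewrite yE.
rewrite (mv_lexx y : _ ⊖ _ = _) => h0.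
by rewrite -(half_double u) -[half u]h0 oplus0.
Qed.

End DeltaTheory.

Theorem theorem5p4 (A : deltaAlgebra) : mv_semisimple A.
Proof.
apply/seteqP; split=> [x Mx|_ -> M [[[M0 _ _] _] _]] //.
by apply: infinitesimal0; apply: maximal_ideal_infinitesimal.
Qed.
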